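(* Let $G=(V,E)$ and $G'=(V',E')$ be directed acyclic graphs, let $\chi=(\mathfrak m,\mathfrak M)$ be a monitor placement for $G$, and let $f:V\to V'$ be a bijective embedding $G\hookrightarrow_f G'$; equip $G'$ with the monitor placement $\chi^f=(f(\mathfrak m),f(\mathfrak M))$. If the path set $\mathbb P(G\mid\chi)$ is routing consistent, then $\mu(G\mid\chi)\le\mu(G'\mid\chi^f)$.
   Context: For a DAG $G$, $u\preceq_G v$ means $v$ is reachable from $u$ by a directed path (including $u=v$). An embedding $f:G\hookrightarrow G'$ is an injective map $V\to V'$ such that for all $u,v\in V$, $u\preceq_G v$ iff $f(u)\preceq_{G'} f(v)$. A monitor placement $(\mathfrak m,\mathfrak M)$ specifies input nodes $\mathfrak m$ and output nodes $\mathfrak M$; $\mathbb P(G\mid\chi)$ is the set of directed measurement paths from a node of $\mathfrak m$ to a node of $\mathfrak M$ (under $\mathrm{CSP}$: simple paths with distinct endpoints; under $\mathrm{CAP}^-$: all such directed walks except single-node paths on a node of $\mathfrak m\cap\mathfrak M$). A set of paths $\mathbb P$ is routing consistent if for any two distinct paths $p,p'\in\mathbb P$ and any distinct nodes $u,w$ traversed by both, $p$ and $p'$ follow the same subpath between $u$ and $w$. $\mathbb P(v)$ is the set of paths through $v$, $\mathbb P(U)=\bigcup_{u\in U}\mathbb P(u)$; $V$ is $k$-identifiable if for all $U,W\subseteq V$, $U\ne W$, $|U|,|W|\le k$, $\mathbb P(U)\neq\mathbb P(W)$; $\mu$ is the largest such $k\ge0$. *)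

(* Defs.v *)
From mathcomp Require Import all_boot.
From mathcomp Require Import boolp classical_sets.

Set Implicit Arguments.
Unset Strict Implicit.
Unset Printing Implicit Defensive.

Local Open Scope classical_set_scope.

(* A directed graph is a finite type of nodes with a boolean edge relation;
   reachability is [connect e] from fingraph.v. *)
Definition acyclic (V : finType) (e : rel V) : Prop :=
  forall c : seq V, cycle e c -> c = [::].

Record placement (V : finType) := Placement {
  inputs : {set V};
  outputs : {set V} }.

Definition map_placement (V V' : finType) (f : V -> V') (chi : placement V) :
    placement V' :=
  Placement (f @: inputs chi) (f @: outputs chi).

Definition embedding (V V' : finType) (e : rel V) (e' : rel V')
    (f : V -> V') : Prop :=
  injective f /\
  forall u v : V, connect e u v <-> connect e' (f u) (f v).

Variant probing := CSP | CAPminus.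

(* A walk is the nonempty sequence of its nodes, [x :: q] with [path e x q];
   [q = [::]] is the single-node path on x. *)
Definition measurement_paths (pi : probing) (V : finType) (e : rel V)
    (chi : placement V) : set (seq V) :=
  [set p : seq V |
    if p is x :: q then
      [/\ path e x q, x \in inputs chi, last x q \in outputs chi &
          match pi with
          | CSP => uniq (x :: q) /\ x <> last x q
          | CAPminus => ~ (q = [::] /\ x \in inputs chi :&: outputs chi)
          end]
    else False].

(* The stretches of p from an occurrence of u to an occurrence of w. When p has
   no repeated node there is at most one, and none if w comes before u. *)
Definition subpaths (V : finType) (p : seq V) (u w : V) : set (seq V) :=
  [set s : seq V | infix s p /\ exists t : seq V, s = u :: rcons t w].

(* Since (u, w) ranges over ordered pairs, the subpaths are compared in both
   directions. *)
Definition routing_consistent (V : finType) (P : set (seq V)) : Prop :=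
  forall p p' : seq V, P p -> P p' -> p <> p' ->
  forall u w : V, u <> w ->
    u \in p -> w \in p -> u \in p' -> w \in p' ->
    subpaths p u w = subpaths p' u w.

Definition paths_through (V : finType) (P : set (seq V)) (v : V) :
    set (seq V) :=
  [set p : seq V | P p /\ v \in p].

Definition paths_through_set (V : finType) (P : set (seq V)) (U : {set V}) :
    set (seq V) :=
  \bigcup_(u in [set` U]) paths_through P u.

Definition identifiable (V : finType) (P : set (seq V)) (k : nat) : Prop :=
  forall U W : {set V}, U <> W -> #|U| <= k -> #|W| <= k ->
    paths_through_set P U <> paths_through_set P W.

(* The maximum is taken over k <= #|V|: if V is #|V|-identifiable, it is
   k-identifiable for every k. By [mu_largest] the bound is immaterial
   for the path set of a nonempty DAG. *)
Definition mu (V : finType) (P : set (seq V)) : nat :=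
  \max_(k < #|V|.+1 | `[< identifiable P k >]) k.

Lemma identifiable0 (V : finType) (P : set (seq V)) : identifiable P 0.
Proof.
move=> U W UW; rewrite !leqn0 !cards_eq0 => /eqP U0 /eqP W0.
by case: UW; rewrite U0 W0.
Qed.

Lemma mu_identifiable (V : finType) (P : set (seq V)) : identifiable P (mu P).
Proof.
apply: (big_ind (identifiable P)) => [|k l kP lP|k /asboolP//].
  exact: identifiable0.
by rewrite /maxn; case: ifP.
Qed.

Lemma mu_largest (pi : probing) (V : finType) (e : rel V) (chi : placement V)
    (k : nat) :
  0 < #|V| -> acyclic e ->
  identifiable (measurement_paths pi e chi) k ->
  k <= mu (measurement_paths pi e chi).
Proof.
set P := measurement_paths pi e chi => /card_gt0P[v _] eA kP.
have kV : k < #|V|.+1.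
  rewrite ltnS leqNgt; apply/negP => Vk.
  pose W := finset.finset (predC1 v).
  apply: (kP (finset.setTfor V) W).
  - by move=> /finset.setP/(_ v); rewrite !finset.inE eqxx.
  - by rewrite cardsT ltnW.
  - by rewrite (leq_trans (max_card _)) // ltnW.
  apply/seteqP; split=> [p [u _ [Pp up]]|p [u _ [Pp up]]]; last first.
    by exists u => //=; rewrite finset.inE.
  suff [w wv wp] : exists2 w, w != v & w \in p.
    by exists w => //=; rewrite !finset.inE wv.
  case: p Pp {up} => [|x q] // [xq xi xo Ppi].
  case: (eqVneq x v) => [xv|]; last by exists x; rewrite ?mem_head.
  case: q xq xo Ppi => [|y q] xq xo Ppi.
    by case: pi @P kP Ppi => _ _ []//; rewrite finset.inE xi xo.
  exists y; last by rewrite !inE eqxx orbT.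
  apply/eqP => yv; move: xq; rewrite xv yv /= => /andP[vv _].
  by have := eA [:: v]; rewrite /= vv => /(_ isT).
rewrite /mu (bigD1 (Ordinal kV)) ?leq_maxl //.
exact/asboolP.
Qed.

(* Main.v *)
Require Import Defs.
From mathcomp Require Import all_boot.
From mathcomp Require Import boolp classical_sets.

Set Implicit Arguments.
Unset Strict Implicit.
Unset Printing Implicit Defensive.

(** Routing consistency forbids a measurement path of G to use an edge u -> w
    that has a node strictly between u and w, since replacing the edge by a
    detour through that node would give a second measurement path. Hence
    measurement paths of G use only covering pairs of the reachability order.
    Any DAG with the same reachability order has an edge at every covering pair,
    so f maps the measurement paths of G to measurement paths of G', and extra
    paths can only help identifiability. *)

Definition covers (V : finType) (e : rel V) (u w : V) : Prop :=
  [/\ u <> w, connect e u w &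
      forall v, connect e u v -> connect e v w -> v = u \/ v = w].

(** [cycle] lists its starting node only once, so the final return to [x] is dropped before
    acyclicity is applied. *)
Lemma acyclic_closed_path (V : finType) (e : rel V) (x : V) (q : seq V) :
  acyclic e -> path e x q -> last x q = x -> q = [::].
Proof.
move=> eA; case/lastP: q => // q y; rewrite last_rcons => xq yx.
by have := eA (x :: q); rewrite /= -{2}yx => /(_ xq).
Qed.

Lemma acyclic_connect_antisym (V : finType) (e : rel V) (u v : V) :
  acyclic e -> connect e u v -> connect e v u -> u = v.
Proof.
move=> eA /connectP[q uq ->] /connectP[r vr ur].
have := @acyclic_closed_path _ _ u (q ++ r) eA.
rewrite cat_path uq vr last_cat -ur => /(_ isT erefl).
by case: q {uq vr ur}.
Qed.

Lemma acyclic_path_uniq (V : finType) (e : rel V) (x : V) (q : seq V) :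
  acyclic e -> path e x q -> uniq (x :: q).
Proof.
move=> eA; elim: q x => // y q IHq x xyq.
rewrite cons_uniq IHq ?andbT; last by case/andP: xyq.
apply/negP => /splitPr xin; case: xin xyq => q1 q2.
rewrite -cat_rcons cat_path => /andP[xq _].
by have := acyclic_closed_path eA xq; rewrite last_rcons => /(_ erefl);
  case: q1 {xq}.
Qed.

Lemma acyclic_edge_neq (V : finType) (e : rel V) (u w : V) :
  acyclic e -> e u w -> u <> w.
Proof.
by move=> eA euw uw; have := eA [:: u]; rewrite /= {2}uw euw => /(_ isT).
Qed.

(** The first node after [u] on a path to [w] lies between the two and differs from [u] by
    acyclicity, so it is [w]. *)
Lemma covers_edge (V : finType) (e : rel V) (u w : V) :
  acyclic e -> covers e u w -> e u w.
Proof.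
move=> eA [uw /connectP[[|v q] /= uq wq] cov]; first by rewrite wq in uw.
case/andP: uq => euv vq.
have vw : connect e v w by apply/connectP; exists q.
case: (cov v (connect1 euv) vw) => [vu|<-//].
by case: (acyclic_edge_neq eA euv).
Qed.

(** By surjectivity, any node between [f u] and [f w] is the image of a node between [u] and [w]. *)
Lemma covers_embedding (V V' : finType) (e : rel V) (e' : rel V') (f : V -> V')
    (u w : V) :
  embedding e e' f -> bijective f -> covers e u w -> covers e' (f u) (f w).
Proof.
move=> [fI fC] [g _ gK] [uw cuw cov]; split.
- by move/fI.
- exact/fC.
move=> v'; rewrite -(gK v') => /fC cu /fC cw.
by case: (cov _ cu cw) => ->; [left|right].
Qed.

(** In a DAG every walk is simple and only single-node walks are closed, so both probing schemes
    just ask for at least one edge. *)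
Lemma measurement_pathsP (pi : probing) (V : finType) (e : rel V)
    (chi : placement V) (x : V) (q : seq V) :
  acyclic e ->
  measurement_paths pi e chi (x :: q) <->
  [/\ path e x q, x \in inputs chi, last x q \in outputs chi & q <> [::]].
Proof.
move=> eA; split=> -[xq xi xo H]; split=> //.
- case: pi H => [[_ H] q0|H q0]; first by rewrite q0 in H.
  by apply: H; split=> //; rewrite finset.inE xi; rewrite q0 in xo.
- case: pi => [|[]//]; split; first exact: acyclic_path_uniq xq.
  by move=> xl; apply: H; apply: acyclic_closed_path xq _.
Qed.

Lemma uniq_cat_cons_inj (T : eqType) (a c s t : seq T) (u : T) :
  uniq (a ++ u :: s) -> a ++ u :: s = c ++ u :: t -> s = t.
Proof.
elim: a c => [|x a IHa] [|y c] /=.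
- by move=> _ [].
- by move=> /andP[us _] [uy sE]; rewrite sE mem_cat mem_head orbT in us.
- by move=> /andP[xs _] [xu _]; rewrite xu mem_cat mem_head orbT in xs.
- by move=> /andP[_ ?] [_]; apply: IHa.
Qed.

(** The splitting at [w] singles out an arbitrary edge of the path, from [last x a] to [w]. *)
Lemma routing_consistent_covers (pi : probing) (V : finType) (e : rel V)
    (chi : placement V) (x : V) (a b : seq V) (w : V) :
  acyclic e -> routing_consistent (measurement_paths pi e chi) ->
  measurement_paths pi e chi (x :: a ++ w :: b) ->
  covers e (last x a) w.
Proof.
move=> eA rc Pp; have [] := (measurement_pathsP _ _ _ _ eA).1 Pp.
rewrite cat_path last_cat /= => /and3P[xa euw wb] xi xo _.
set u := last x a in euw xo *.
have uw := acyclic_edge_neq eA euw.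
split=> // [|v cuv cvw]; first exact: connect1.
have [->|/eqP vu] := eqVneq v u; first by left.
have [->|/eqP vw] := eqVneq v w; first by right.
(* Once the final [w] is removed from [s], the sequence [r ++ s] is the interior of a detour from
   [u] through [v] to [w]. *)
have [r ur vr] := connectP cuv; have [s vs ws] := connectP cvw.
case/lastP: s vs ws => [|s w'] vs; first by move=> wv; case: vw.
rewrite last_rcons => ww'; rewrite -{}ww' in vs.
have Pp' : measurement_paths pi e chi (x :: a ++ (r ++ s) ++ w :: b).
  apply/measurement_pathsP => //; split=> //.
  - move: vs; rewrite rcons_path !cat_path /= -/u last_cat -vr.
    by move=> /andP[vs sw]; rewrite xa ur vs sw.
  - by rewrite last_cat last_cat.
  - by case: (a) (r ++ s) => [|? ?] [].
have rs0 : r ++ s <> [::] by case: r ur vr {Pp'} => // _ vu'; case: vu.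
(* This exposes [u] as the last node of [x :: a]; it is [x] itself when [a] is empty. *)
have aE t : x :: a ++ t = belast x a ++ u :: t.
  by rewrite -cat_cons lastI cat_rcons.
have uniq' : uniq (belast x a ++ u :: (r ++ s) ++ w :: b).
  have [xp _ _ _] := (measurement_pathsP _ _ _ _ eA).1 Pp'.
  by rewrite -aE; apply: acyclic_path_uniq xp.
have pp' : x :: a ++ w :: b <> x :: a ++ (r ++ s) ++ w :: b.
  move/(congr1 size); rewrite /= !(size_cat, addnA) => -[] /addIn.
  rewrite -addnA -size_cat -{1}[size a]addn0 => /addnI/esym/size0nil.
  exact: rs0.
have sub : subpaths (x :: a ++ w :: b) u w [:: u; w].
  split; last by exists [::].
  by rewrite aE; apply/infixP; exists (belast x a), b.
(* The detour path is simple and continues from [u] with [r ++ s], so [u; w]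
   cannot be a stretch of it. *)
rewrite (rc _ _ Pp Pp' pp' _ _ uw) in sub; rewrite ?aE ?mem_cat ?inE ?mem_cat
  ?inE ?eqxx ?orbT //.
case: sub => /infixP[c [d]]; rewrite aE /= => /(uniq_cat_cons_inj uniq').
case: (r ++ s) rs0 uniq' => // z t _ uniq' [zw _]; move: uniq'.
by rewrite zw cat_uniq /= mem_cat mem_head !(orbT, andbF).
Qed.

Lemma routing_consistent_map_path (pi : probing) (V V' : finType) (e : rel V)
    (e' : rel V') (chi : placement V) (f : V -> V') (p : seq V) :
  acyclic e -> acyclic e' -> embedding e e' f -> bijective f ->
  routing_consistent (measurement_paths pi e chi) ->
  measurement_paths pi e chi p ->
  measurement_paths pi e' (map_placement f chi) (map f p).
Proof.
move=> eA e'A fE fB rc; case: p => // x q Pp.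
have [_ xi xo q0] := (measurement_pathsP _ _ _ _ eA).1 Pp.
apply/(measurement_pathsP _ _ _ _ e'A); split; last by case: (q) q0.
(* Quantifying over all splittings of [q] lets the induction pass to the tail. *)
- have: forall a w b, q = a ++ w :: b -> e' (f (last x a)) (f w).
    move=> a w b qE; apply: covers_edge e'A (covers_embedding fE fB _).
    by rewrite qE in Pp; apply: routing_consistent_covers eA rc Pp.
  elim: (q) (x) => //= y r IHr z edge.
  rewrite (edge [::] y r erefl) /=; apply: IHr => a w b rE.
  by apply: (edge (y :: a) w b); rewrite rE.
- exact: imset_f.
- by rewrite last_map; apply: imset_f.
Qed.

(** Preimages of distinct sets are distinct and keep their sizes, so some path of [P] meets exactly
    one of them; its image in [P'] separates the original sets. *)
Lemma identifiable_map (V V' : finType) (P : set (seq V)) (P' : set (seq V'))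
    (f : V -> V') (k : nat) :
  bijective f -> (forall p, P p -> P' (map f p)) ->
  identifiable P k -> identifiable P' k.
Proof.
move=> fB PP' Pk U W UW Uk Wk eqP'.
have fI := bij_inj fB.
have throughE (X : {set V'}) p : P p ->
    paths_through_set P (f @^-1: X) p <-> paths_through_set P' X (map f p).
  move=> Pp; split=> [[v /= vX [_ vp]]|[v' /= vX [_ /mapP[v vp vE]]]].
    exists (f v); first by rewrite finset.inE in vX.
    by split; [exact: PP' | rewrite mem_map].
  by exists v => //=; rewrite finset.inE -vE.
have card_pre (X : {set V'}) : #|f @^-1: X| = #|X|.
  by rewrite on_card_preimset //; apply: onW_bij.
apply: (Pk (f @^-1: U) (f @^-1: W)); rewrite ?card_pre //.
- case: fB => g _ gK /finset.setP pre; apply: UW; apply/finset.setP => v'.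
  by have := pre (g v'); rewrite !finset.inE gK.
- apply/seteqP; split=> p pX; have Pp : P p by case: pX => ? _ [].
    by apply/throughE => //; rewrite -eqP'; apply/throughE.
  by apply/throughE => //; rewrite eqP'; apply/throughE.
Qed.

Theorem theorem7 (pi : probing) (V V' : finType) (e : rel V) (e' : rel V')
    (chi : placement V) (f : V -> V') :
  acyclic e -> acyclic e' ->
  embedding e e' f -> bijective f ->
  routing_consistent (measurement_paths pi e chi) ->
  mu (measurement_paths pi e chi)
    <= mu (measurement_paths pi e' (map_placement f chi)).
Proof.
move=> eA e'A fE fB rc.
(* [mu_largest] requires a node. If [V'] is empty, so is [V], and the maximum defining the left side
   ranges over 0 only. *)
have [V'0|V'0] := posnP #|V'|.
  by apply/bigmax_leqP => k _; rewrite -ltnS (leq_trans (ltn_ord k)) //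
    (bij_eq_card fB) V'0.
apply: mu_largest => //; apply: (identifiable_map fB) (@mu_identifiable _ _).
by move=> p; apply: routing_consistent_map_path.
Qed.
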